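(* Assume $MA_{ma}(\omega_1)$. Let $X_\alpha$ ($\alpha<\kappa$) be spaces in $MS$, let $a \in \prod_{\alpha<\kappa} X_\alpha$, and let $Y$ be a compact subspace of the $\Sigma$-product $\Sigma(a)$. Then $Y \in MS$.
   Context: All spaces are Hausdorff. $MS$ is the class of compact Hausdorff spaces $X$ such that every Radon measure (finite regular Borel measure) on $X$ is separable, where a measure is separable iff its measure algebra (Borel sets modulo null sets, with metric $d(A,B)=\mu(A\triangle B)$) is separable as a metric space. For spaces $X_\alpha$ ($\alpha<\kappa$) and a point $a=\langle a_\alpha:\alpha<\kappa\rangle$ of the Tychonov product $\prod_\alpha X_\alpha$, the $\Sigma$-product with base point $a$ is the subspace $\Sigma(a)$ of the Tychonov product consisting of all points $x$ with $x_\alpha \ne a_\alpha$ for only countably many $\alpha$. $MA_{ma}(\omega_1)$ is the statement that for every ccc partial order which is (the non-zero elements of) a measure algebra and every family of $\omega_1$ dense subsets of it, there is a filter meeting all of them. *)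

(* Defs.v *)
From HB Require Import structures.
From mathcomp Require Import all_boot all_order all_algebra.
From mathcomp Require Import all_classical all_reals all_analysis.
From mathcomp Require Import generic_quotient wochoice.

Set Implicit Arguments.
Unset Strict Implicit.
Unset Printing Implicit Defensive.

Import Order.TTheory GRing.Theory Num.Theory.
Import numFieldNormedType.Exports.

Local Open Scope classical_set_scope.
Local Open Scope ring_scope.

Section measure_algebra_of_measure.
Context d (T : measurableType d) (R : realType).
Variable mu : {finite_measure set T -> \bar R}.

Definition null_eq (A B : (measurable : set (set T))) : bool :=
  mu (val A `+` val B) == 0%E.

Let msetY (A B : (measurable : set (set T))) : measurable (val A `+` val B).
Proof.
have mA := set_mem (valP A); have mB := set_mem (valP B).
by rewrite /setY; apply: measurableU; apply: measurableD.
Qed.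

Let finY (A B : (measurable : set (set T))) : mu (val A `+` val B) \is a fin_num.
Proof. exact/fin_num_measure/msetY. Qed.

Let setY_triangle (A B C : (measurable : set (set T))) :
  (mu (val A `+` val C) <= mu (val A `+` val B) + mu (val B `+` val C))%E.
Proof.
apply: (@le_trans _ _ (mu ((val A `+` val B) `|` (val B `+` val C)))).
  apply: le_measure; rewrite ?inE; [exact: msetY| |].
    by apply: measurableU; exact: msetY.
  move=> x; rewrite /setY/= => -[[Ax nCx]|[Cx nAx]];
    have [Bx|nBx] := pselect (val B x); tauto.
by apply: measureU2; exact: msetY.
Qed.

Lemma null_eq_equiv : equiv_class_of null_eq.
Proof.
split=> [A|A B|B A C]; rewrite /null_eq.
- by rewrite setYK measure0.
- by rewrite setYC.
- move=> /eqP AB /eqP BC; rewrite eq_le measure_ge0 andbT.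
  by rewrite (le_trans (setY_triangle A B C))// AB BC adde0.
Qed.

Canonical null_eq_equivRel := EquivRelPack null_eq_equiv.

(* Measurable sets modulo null sets. *)
Definition measure_algebra : Type := {eq_quot null_eq_equivRel}%qT.

HB.instance Definition _ := Choice.on measure_algebra.

Definition measure_class (A : (measurable : set (set T))) : measure_algebra :=
  (\pi_({eq_quot null_eq_equivRel}%qT) A)%qT.

Definition measure_algebra_dist (a b : measure_algebra) : R :=
  fine (mu (val (repr a) `+` val (repr b))).

Let reprK (a : measure_algebra) : measure_class (repr a) = a.
Proof. exact: reprK. Qed.

Let classP (A B : (measurable : set (set T))) :
  reflect (measure_class A = measure_class B) (null_eq A B).
Proof. exact: (@eqquotP _ null_eq_equivRel {eq_quot null_eq_equivRel}%qT). Qed.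

Lemma measure_algebra_distE A B :
  measure_algebra_dist (measure_class A) (measure_class B) =
  fine (mu (val A `+` val B)).
Proof.
have H C : mu (val C `+` val (repr (measure_class C))) = 0%E.
  by apply/eqP; exact/classP/esym/reprK.
have H' C : mu (val (repr (measure_class C)) `+` val C) = 0%E.
  by rewrite setYC.
congr fine; apply/eqP; rewrite eq_le; apply/andP; split.
- rewrite (le_trans (setY_triangle _ A _))// H' add0e.
  by rewrite (le_trans (setY_triangle _ B _))// H adde0.
- rewrite (le_trans (setY_triangle _ (repr (measure_class A)) _))// H add0e.
  by rewrite (le_trans (setY_triangle _ (repr (measure_class B)) _))// H' adde0.
Qed.

Let dist0 a : measure_algebra_dist a a = 0.
Proof. by rewrite /measure_algebra_dist setYK measure0. Qed.

Let dist_eq0 a b : measure_algebra_dist a b = 0 -> a = b.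
Proof.
rewrite /measure_algebra_dist => ab; rewrite -(reprK a) -(reprK b).
by apply/classP; rewrite /null_eq -(fineK (finY _ _)) ab.
Qed.

Let distC a b : measure_algebra_dist a b = measure_algebra_dist b a.
Proof. by rewrite /measure_algebra_dist setYC. Qed.

Let dist_triangle b a c : measure_algebra_dist a c <=
  measure_algebra_dist a b + measure_algebra_dist b c.
Proof.
by rewrite /measure_algebra_dist -fineD// fine_le ?fin_numD ?finY// setY_triangle.
Qed.

HB.instance Definition _ :=
  isMetric.Build R measure_algebra dist0 dist_eq0 distC dist_triangle.

End measure_algebra_of_measure.

Definition separable_space (T : topologicalType) :=
  exists2 D : set T, countable D & dense D.

Definition separable_measure d (T : measurableType d) (R : realType)
    (mu : {finite_measure set T -> \bar R}) :=
  separable_space (measure_algebra mu).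

(* The library requires measurable types to be pointed, whereas a compact space
   may be empty. [pointed_at x0] is [T] with [x0] as its distinguished point;
   the topology and the Borel sets do not depend on [x0]. *)
Definition pointed_at (T : topologicalType) (x0 : T) : Type := T.

HB.instance Definition _ (T : topologicalType) (x0 : T) :=
  Topological.on (pointed_at x0).
HB.instance Definition _ (T : topologicalType) (x0 : T) :=
  isPointed.Build (pointed_at x0) x0.

Definition borel (T : topologicalType) (x0 : T) :=
  g_sigma_algebraType (@open (pointed_at x0)).

Definition regular_measure (R : realType) (T : topologicalType) (x0 : T)
    (mu : {finite_measure set (borel x0) -> \bar R}) :=
  forall A : set (borel x0), measurable A ->
    mu A = ereal_sup [set mu K | K in [set K : set T | compact K /\ K `<=` A]]
    /\
    mu A = ereal_inf [set mu U | U in [set U : set T | open U /\ A `<=` U]].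

(* If [T] is empty the last clause is vacuous, in agreement with the fact that
   the only measure on the empty space is the zero measure. *)
Definition MS (R : realType) (T : topologicalType) :=
  [/\ compact [set: T],
      hausdorff_space T &
      forall (x0 : T) (mu : {finite_measure set (borel x0) -> \bar R}),
        regular_measure mu -> separable_measure mu].

Definition Sigma_product (I : Type) (X : I -> topologicalType)
    (a : prod_topology X) : set (prod_topology X) :=
  [set x | countable [set i | x i <> a i]].

Section forcing.
Context d (P : porderType d).

Definition compatible (p q : P) := exists r : P, (r <= p)%O /\ (r <= q)%O.

Definition ccc := forall A : set P,
  (forall p q, A p -> A q -> p <> q -> ~ compatible p q) -> countable A.

Definition forcing_dense (D : set P) :=
  forall p : P, exists2 q, D q & (q <= p)%O.

Definition forcing_filter (G : set P) :=
  [/\ G !=set0,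
      forall p q, G p -> (p <= q)%O -> G q &
      forall p q, G p -> G q -> exists r, [/\ G r, (r <= p)%O & (r <= q)%O]].

End forcing.

(* [R] well-orders [W] in type omega_1: [W] is uncountable and its proper
   initial segments are countable. *)
Definition is_omega1 (W : Type) (R : rel W) :=
  [/\ well_order R, ~ countable [set: W] &
      forall w, countable [set v | R v w]].

Definition MA_omega1_at d (P : porderType d) :=
  forall (W : Type) (lew : rel W), is_omega1 lew ->
  forall D : W -> set P, (forall w, forcing_dense (D w)) ->
  exists2 G : set P, forcing_filter G & forall w, G `&` D w !=set0.

Section nonzero.
Context d (B : ctbDistrLatticeType d).

Definition nonzero : Type := {b : B | b != \bot%O}.

HB.instance Definition _ := SubChoice.on nonzero.
HB.instance Definition _ := [SubChoice_isSubPOrder of nonzero by <: with d].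

End nonzero.

(* [m] is finite-valued by typing. *)
Definition is_measure_algebra (R : realType) d (B : ctbDistrLatticeType d)
    (m : B -> R) :=
  [/\ forall b : nat -> B, supremums (range b) !=set0,
      forall b, 0 <= m b,
      forall b, m b = 0 <-> b = \bot%O &
      forall (b : nat -> B) (s : B),
        (forall i j, i != j -> (b i `&` b j)%O = \bot%O) ->
        supremums (range b) s ->
        series (m \o b) @ \oo --> m s].

(* The trivial algebra has to be excluded: its poset of nonzero elements is
   empty and carries no filter. *)
Definition MA_ma_omega1 (R : realType) :=
  forall d (B : ctbDistrLatticeType d) (m : B -> R),
    is_measure_algebra m -> \bot%O != \top%O :> B ->
    ccc (nonzero B) -> MA_omega1_at (nonzero B).

(* Main.v *)
From HB Require Import structures.
Require Import Defs.
From mathcomp Require Import finmap.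
From mathcomp Require Import all_boot all_order all_algebra.
From mathcomp Require Import all_classical all_reals all_analysis.
From mathcomp Require Import ring.
From mathcomp Require Import wochoice.

(* Let mu be a Radon measure on Y. The coordinates i for which the open set
   {x | x_i <> a_i} has positive measure are countably many: otherwise, shrink
   omega_1 of these sets to compact sets K_i of positive measure; MA_ma(omega_1)
   gives an uncountable subfamily with the finite intersection property, and a
   point common to it differs from a at uncountably many coordinates. For the
   other coordinates the preimage of an open set is null or conull. The images
   of mu under the countably many remaining projections are separable by
   assumption; pulling back countable dense families and closing under finite
   unions and intersections gives a countable family that approximates every
   basic open set, hence, by regularity and compactness, every Borel set. *)

Set Implicit Arguments.
Unset Strict Implicit.
Unset Printing Implicit Defensive.

Import Order.TTheory GRing.Theory Num.Theory.
Import numFieldNormedType.Exports.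

Local Open Scope classical_set_scope.
Local Open Scope ring_scope.

(** * The measure algebra of a finite measure as a Boolean algebra *)

Lemma aeI d (T : measurableType d) (R : realType)
    (mu : {measure set T -> \bar R}) (P Q : T -> Prop) :
  {ae mu, forall x, P x} -> {ae mu, forall x, Q x} ->
  {ae mu, forall x, P x /\ Q x}.
Proof. by apply: filterS2. Qed.

Section measure_algebra_lattice.
Context d (T : measurableType d) (R : realType).
Variable mu : {finite_measure set T -> \bar R}.
Local Notation B := (measure_algebra mu).
Implicit Types a b c : B.

Definition class_of_set (A : set T) (mA : measurable A) : B :=
  measure_class mu (exist _ A (mem_set mA)).

Definition repr_set a : set T := val (repr a).

Lemma measurable_repr_set a : measurable (repr_set a).
Proof. exact: set_mem (valP (repr a)). Qed.

(** This bridge between the metric and almost everywhere equality lets identities between classes be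
    proved by combining almost everywhere statements as filter elements. *)
Lemma null_setYP (A A' : set T) : measurable A -> measurable A' ->
  mu (A `+` A') = 0%E <-> {ae mu, forall x, A x <-> A' x}.
Proof.
move=> mA mA'; have mAA' : measurable (A `+` A').
  by apply: measurableU; exact: measurableD.
rewrite -(negligibleP mu mAA'); split; apply: negligibleS => x /=; last first.
  by rewrite /setY /=; tauto.
by rewrite /setY /=; have [] := pselect (A x); have [] := pselect (A' x); tauto.
Qed.

Lemma repr_setK a : class_of_set (measurable_repr_set a) = a.
Proof.
rewrite -[RHS]reprK; congr measure_class.
by apply/val_inj.
Qed.

Lemma class_of_setP (A A' : set T) (mA : measurable A) (mA' : measurable A') :
  class_of_set mA = class_of_set mA' <-> {ae mu, forall x, A x <-> A' x}.
Proof.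
rewrite -null_setYP//; split=> [|AA'].
  by move=> /(@eqquotP _ (null_eq_equivRel mu) _) /eqP.
by apply/(@eqquotP _ (null_eq_equivRel mu) _)/eqP.
Qed.

Lemma repr_class_of_set (A : set T) (mA : measurable A) :
  {ae mu, forall x, repr_set (class_of_set mA) x <-> A x}.
Proof. by apply/(class_of_setP (measurable_repr_set _)); rewrite repr_setK. Qed.

Lemma measure_algebra_eqP a b :
  a = b <-> {ae mu, forall x, repr_set a x <-> repr_set b x}.
Proof.
by rewrite -(class_of_setP (measurable_repr_set a) (measurable_repr_set b))
  !repr_setK.
Qed.

(** The operations act on chosen representatives, which obey the set operations only up to null
    sets. Each law of a Boolean algebra thus becomes a propositional tautology at almost every
    point. *)
Definition ma_meet a b : B :=
  class_of_set (measurableI _ _ (measurable_repr_set a) (measurable_repr_set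
    b)).
Definition ma_join a b : B :=
  class_of_set (measurableU _ _ (measurable_repr_set a) (measurable_repr_set
    b)).
Definition ma_compl a : B := class_of_set (measurableC (measurable_repr_set a)).
Definition ma_bottom : B := class_of_set measurable0.
Definition ma_top : B := class_of_set measurableT.
Definition ma_le a b := ma_meet a b == a.
Definition ma_lt a b := (b != a) && ma_le a b.

Let meetP a b : {ae mu, forall x,
  repr_set (ma_meet a b) x <-> repr_set a x /\ repr_set b x}.
Proof. exact: repr_class_of_set. Qed.

Let joinP a b : {ae mu, forall x,
  repr_set (ma_join a b) x <-> repr_set a x \/ repr_set b x}.
Proof. exact: repr_class_of_set. Qed.

Let complP a : {ae mu, forall x, repr_set (ma_compl a) x <-> ~ repr_set a x}.
Proof. exact: repr_class_of_set. Qed.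

Let bottomP : {ae mu, forall x, ~ repr_set ma_bottom x}.
Proof. by move: (repr_class_of_set measurable0); apply: filterS => x []. Qed.

Let topP : {ae mu, forall x, repr_set ma_top x}.
Proof.
by move: (repr_class_of_set measurableT); apply: filterS => x [_]; exact.
Qed.

Let meetC : commutative ma_meet.
Proof.
move=> a b; apply/measure_algebra_eqP.
by move: (meetP a b) (meetP b a); apply: filterS2 => x; tauto.
Qed.

Let joinC : commutative ma_join.
Proof.
move=> a b; apply/measure_algebra_eqP.
by move: (joinP a b) (joinP b a); apply: filterS2 => x; tauto.
Qed.

Let meetA : associative ma_meet.
Proof.
move=> a b c; apply/measure_algebra_eqP.
have := aeI (meetP a b) (meetP b c).
move: (meetP a (ma_meet b c)) (meetP (ma_meet a b) c).
by apply: filterS3 => x; tauto.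
Qed.

Let joinA : associative ma_join.
Proof.
move=> a b c; apply/measure_algebra_eqP.
have := aeI (joinP a b) (joinP b c).
move: (joinP a (ma_join b c)) (joinP (ma_join a b) c).
by apply: filterS3 => x; tauto.
Qed.

Let joinKI b a : ma_meet a (ma_join a b) = a.
Proof.
apply/measure_algebra_eqP; move: (meetP a (ma_join a b)) (joinP a b).
by apply: filterS2 => x; tauto.
Qed.

Let meetKU b a : ma_join a (ma_meet a b) = a.
Proof.
apply/measure_algebra_eqP; move: (joinP a (ma_meet a b)) (meetP a b).
by apply: filterS2 => x; tauto.
Qed.

Let meetUl : left_distributive ma_meet ma_join.
Proof.
move=> a b c; apply/measure_algebra_eqP.
have := aeI (joinP a b) (joinP (ma_meet a c) (ma_meet b c)).
have := aeI (meetP a c) (meetP b c).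
move: (meetP (ma_join a b) c).
by apply: filterS3 => x; tauto.
Qed.

Let meetxx : idempotent_op ma_meet.
Proof.
move=> a; apply/measure_algebra_eqP; move: (meetP a a).
by apply: filterS => x; tauto.
Qed.

HB.instance Definition _ := @Order.isMeetJoinDistrLattice.Build
  (Order.Disp tt tt) B ma_le ma_lt ma_meet ma_join (fun _ _ => erefl)
  (fun _ _ => erefl) meetC joinC meetA joinA joinKI meetKU meetUl meetxx.

Lemma repr_set_meet a b :
  {ae mu, forall x, repr_set (a `&` b)%O x <-> repr_set a x /\ repr_set b x}.
Proof. exact: meetP. Qed.

Lemma measure_algebra_leP a b :
  (a <= b)%O <-> {ae mu, forall x, repr_set a x -> repr_set b x}.
Proof.
rewrite leEmeet; split=> [/eqP/measure_algebra_eqP|le_ab].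
  by move: (repr_set_meet a b); apply: filterS2 => x; tauto.
apply/eqP/measure_algebra_eqP.
by move: (repr_set_meet a b) le_ab; apply: filterS2 => x; tauto.
Qed.

Let le0x a : (ma_bottom <= a)%O.
Proof. by apply/measure_algebra_leP; apply: filterS bottomP. Qed.

Let lex1 a : (a <= ma_top)%O.
Proof. by apply/measure_algebra_leP; apply: filterS topP. Qed.

HB.instance Definition _ := Order.hasBottom.Build _ B le0x.
HB.instance Definition _ := Order.hasTop.Build _ B lex1.

Let joinxC a : (a `|` ma_compl a)%O = \top%O.
Proof.
apply/measure_algebra_eqP; move: (joinP a (ma_compl a)) (complP a) topP.
apply: filterS3 => x; rewrite -[Order.join _ _]/(ma_join a (ma_compl a)).
by rewrite -[\top%O]/ma_top; have [] := pselect (repr_set a x); tauto.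
Qed.

Let meetxC a : (a `&` ma_compl a)%O = \bot%O.
Proof.
apply/measure_algebra_eqP; move: (meetP a (ma_compl a)) (complP a) bottomP.
apply: filterS3 => x; rewrite -[Order.meet _ _]/(ma_meet a (ma_compl a)).
by rewrite -[\bot%O]/ma_bottom; have [] := pselect (repr_set a x); tauto.
Qed.

HB.instance Definition _ :=
  Order.TBDistrLattice_hasComplement.Build _ B joinxC meetxC.

Lemma repr_set_bot : {ae mu, forall x, ~ repr_set (\bot%O : B) x}.
Proof. exact: bottomP. Qed.

Lemma repr_set_top : {ae mu, forall x, repr_set (\top%O : B) x}.
Proof. exact: topP. Qed.

Definition ma_measure a : R := fine (mu (repr_set a)).

End measure_algebra_lattice.

(** * The measure on the algebra, and the countable chain condition *)

Lemma ae_le_measure d (T : measurableType d) (R : realType)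
    (mu : {measure set T -> \bar R}) (A A' : set T) :
  measurable A -> measurable A' -> {ae mu, forall x, A x -> A' x} ->
  (mu A <= mu A')%E.
Proof.
move=> mA mA' AA'; have mD : measurable (A `\` A') by exact: measurableD.
have D0 : mu (A `\` A') = 0%E.
  apply/(negligibleP mu mD); apply: negligibleS AA' => x [Ax nA'x] /=.
  by move=> /(_ Ax).
rewrite -(measureU0 mA' mD D0); apply: le_measure; rewrite ?inE//.
  exact: measurableU.
by move=> x Ax; have [A'x|nA'x] := pselect (A' x); [left|right].
Qed.

Lemma ae_eq_measure d (T : measurableType d) (R : realType)
    (mu : {measure set T -> \bar R}) (A A' : set T) :
  measurable A -> measurable A' -> {ae mu, forall x, A x <-> A' x} ->
  mu A = mu A'.
Proof.
move=> mA mA' AA'; apply/eqP; rewrite eq_le; apply/andP; split;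
  by apply: ae_le_measure => //; apply: filterS AA' => x [].
Qed.

Section measure_algebra_is_measure_algebra.
Context d (T : measurableType d) (R : realType).
Variable mu : {finite_measure set T -> \bar R}.
Local Notation B := (measure_algebra mu).

Let sup_class (b : nat -> B) : B := class_of_set mu
  (bigcup_measurable (fun n (_ : [set: nat] n) => measurable_repr_set (b n))).

Let sup_classP (b : nat -> B) : supremums (range b) (sup_class b).
Proof.
have supP := repr_class_of_set mu
  (bigcup_measurable (fun n (_ : [set: nat] n) => measurable_repr_set (b n))).
split=> [_ [n _ <-]|c ubc]; apply/measure_algebra_leP.
  by move: supP; apply: filterS => x [_ supx] bx; apply: supx; exists n.
have : {ae mu, forall x, forall n, repr_set (b n) x -> repr_set c x}.
  by apply: ae_foralln => n; apply/measure_algebra_leP; apply: ubc; exists n.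
by move: supP; apply: filterS2 => x [+ _] bc; move=> /[apply] -[n _ /bc].
Qed.

Let ma_measure_eq0 (b : B) : ma_measure b = 0 <-> b = \bot%O.
Proof.
have mb := measurable_repr_set b.
rewrite /ma_measure; split=> [b0|->]; last first.
  rewrite (_ : mu _ = 0%E)//; apply/(negligibleP mu); last first.
    by move: (repr_set_bot mu); apply: negligibleS => x /=; tauto.
  exact: measurable_repr_set.
have {}b0 : mu (repr_set b) = 0%E.
  by rewrite -[LHS]fineK ?b0//; exact: fin_num_measure.
apply/measure_algebra_eqP; move: (repr_set_bot mu).
have : {ae mu, forall x, ~ repr_set b x}.
  have /(negligibleP mu mb) := b0.
  by apply: negligibleS => x /=; have [] := pselect (repr_set b x); tauto.
by apply: filterS2 => x; tauto.
Qed.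

(** Countable suprema are classes of unions of representatives. For additivity, representatives of
    disjoint classes are only almost disjoint; the truly disjoint sets [seqDU F n] have the same
    union and differ from [F n] by null sets. *)
Lemma measure_algebra_is_measure_algebra :
  is_measure_algebra (@ma_measure _ T R mu).
Proof.
split=> [b|b|b|b s disj sups].
- by exists (sup_class b).
- by rewrite /ma_measure fine_ge0.
- exact: ma_measure_eq0.
(* Suprema are unique by antisymmetry, so the concrete one may replace [s]. *)
have -> : s = sup_class b.
  have [[s1 s2] [c1 c2]] := (sups, sup_classP b).
  by apply/eqP; rewrite eq_le s2//= c2.
pose F n := repr_set (b n).
have mF n : measurable (F n) by exact: measurable_repr_set.
have mU : measurable (\bigcup_n F n) by exact: bigcup_measurable.
have mD n : measurable (seqDU F n).
  by apply: measurableD => //; exact: bigsetU_measurable.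
have FE n : mu (F n) = mu (seqDU F n).
  apply: ae_eq_measure => //.
  have : {ae mu, forall x, forall m, (m < n)%N -> ~ (F m x /\ F n x)}.
    apply: ae_foralln => m; have [mn|] := ltnP m n; last first.
      by move=> _; apply: aeW.
    have /measure_algebra_eqP : (b m `&` b n)%O = \bot%O.
      by apply: disj; rewrite ltn_eqF.
    move: (repr_set_meet (b m) (b n)) (repr_set_bot mu).
    by apply: filterS3 => x; rewrite -/(F m) -/(F n); tauto.
  apply: filterS => x FF; split=> [Fnx|[]//]; split=> //.
  rewrite -bigcup_mkord => -[m /= mn Fmx].
  exact: (FF m mn).
have sE : mu (repr_set (sup_class b)) = mu (\bigcup_n F n).
  apply: ae_eq_measure => //; first exact: measurable_repr_set.
  exact: repr_class_of_set.
have : (fun n => (\sum_(0 <= i < n) mu (F i))%E) @ \oo -->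
    (ma_measure (sup_class b))%:E.
  rewrite /ma_measure fineK ?sE; last exact: fin_num_measure.
  rewrite seqDU_bigcup_eq; under eq_fun do under eq_bigr do rewrite FE.
  apply: measure_semi_sigma_additive => //.
  by rewrite -seqDU_bigcup_eq.
move=> /fine_cvg; rewrite (_ :
  fine \o _ = series (@ma_measure _ T R mu \o b))//.
by apply/funext => n /=; rewrite -sum_fine// => i _; exact: fin_num_measure.
Qed.

End measure_algebra_is_measure_algebra.

Definition to_nonzero d (B : ctbDistrLatticeType d) (b : B)
  (b0 : b != \bot%O) : nonzero B := exist _ b b0.

(** The members of an antichain with measure above [1/(n+1)] are finite in number: infinitely many
    would give a disjoint sequence whose measures form a convergent series, so they would tend to 0.
    By strict positivity these finite pieces exhaust the antichain. *)
Lemma measure_algebra_ccc (R : realType) d (B : ctbDistrLatticeType d)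
    (m : B -> R) : is_measure_algebra m -> ccc (nonzero B).
Proof.
move=> [sup m_ge0 m_eq0 m_add] A antiA.
pose A_ n := [set p | A p /\ n.+1%:R^-1 < m (val p)].
suff finA n : finite_set (A_ n).
  rewrite (_ : A = \bigcup_n A_ n); last first.
    apply/seteqP; split=> [p Ap|p [n _ []]//].
    have mp : 0 < m (val p).
      by rewrite lt0r m_ge0 andbT; apply: contra (valP p) => /eqP/m_eq0/eqP.
    have [n n_gt] := ltr_add_invr mp.
    by exists n => //; split=> //; rewrite add0r in n_gt.
  by apply: bigcup_countable => // n _; exact: finite_set_countable.
apply: contrapT => /infiniteP/card_leP[f].
pose g (k : nat) : nonzero B :=
  set_val (f (SigSub (mem_set (Logic.I : [set: nat] k)))).
have gA k : A_ n (g k) by exact: set_valP.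
have g_inj : injective g.
  by move=> i j /val_inj/inj fij;
    have [] := fij (mem_set Logic.I) (mem_set Logic.I).
have disj i j : i != j -> (val (g i) `&` val (g j))%O = \bot%O.
  move=> ij; apply: contrapT => /eqP meet_neq0.
  have [Agi _] := gA i; have [Agj _] := gA j.
  apply: (antiA _ _ Agi Agj); first by move/g_inj; exact/eqP.
  by exists (to_nonzero meet_neq0); split; rewrite leEsub/= ?leIl ?leIr.
have [s sups] := sup (val \o g).
have : cvgn (series (m \o (val \o g))).
  by apply/cvg_ex; exists (m s); exact: m_add disj sups.
move/cvg_series_cvg_0/cvgrPdist_lt.
have n0 : 0 < n.+1%:R^-1 :> R by rewrite invr_gt0 ltr0n.
move=> /(_ _ n0) [k _ /(_ k (leqnn k))] /=.
rewrite sub0r normrN ger0_norm// => mk_lt.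
by have [_] := gA k; rewrite ltNge ltW.
Qed.

(** * Subsets of order type omega_1 *)

Lemma well_order_relpre (T U : eqType) (f : U -> T) (r : rel T) :
  injective f -> well_order r -> well_order (relpre f r).
Proof.
move=> f_inj wo; have anti := wo_chain_antisymmetric (withinW (A := predT) wo).
apply: antisymmetric_well_order => [x y rxy|A [x Ax]].
  by apply: f_inj; exact: anti rxy.
have [|_ [[/asboolP[y Ay <-] miny] _]] :=
  wo [pred t | `[< (f @` [set` A]) t >]].
  by exists (f x); apply/asboolP; exists x.
by exists y; split=> // z Az; apply: miny; apply/asboolP; exists z.
Qed.

Lemma countable_image T U (f : T -> U) (A : set T) :
  countable A -> countable (f @` A).
Proof. exact/sub_countable/card_image_le. Qed.

Lemma countable_preimage T U (f : T -> U) (A : set U) :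
  injective f -> countable A -> countable (f @^-1` A).
Proof.
move=> f_inj /countable_injP[g g_inj]; apply/countable_injP.
by exists (g \o f) => x y /set_mem Ax /set_mem Ay /= /g_inj/f_inj; apply;
  exact/mem_set.
Qed.

(** Well-order [I]. Either every initial segment of [J] is countable and [J] itself serves, or the
    segment below the least point with an uncountable segment does. *)
Lemma uncountable_omega1 (I : choiceType) (J : set I) : ~ countable J ->
  exists2 A : set I, A `<=` J & exists r : rel A, is_omega1 r.
Proof.
move=> J_unc; have [r wo] := well_ordering_principle I.
have tot := wo_chainW (withinW (A := predT) wo).
have anti := wo_chain_antisymmetric (withinW (A := predT) wo).
pose seg w := J `&` [set v | r v w].
suff [A [AJ A_unc segA]] : exists A : set I,
    [/\ A `<=` J, ~ countable A & forall w, A w -> countable (seg w)].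
  exists A => //; exists (relpre val r); split.
  - exact: well_order_relpre val_inj wo.
  - move=> /(countable_image val) c; apply: A_unc; apply: sub_countable c.
    by apply: subset_card_le => w Aw; exists (SigSub (mem_set Aw)).
  - move=> w; apply: sub_countable (countable_preimage val_inj (segA _ (set_mem
      (valP w)))).
    by apply: subset_card_le => v rvw; split=> //; exact: AJ (set_mem (valP v)).
have [all_c|] := pselect (forall w, J w -> countable (seg w));
  first by exists J; split.
move=> /existsNP[w1 /not_implyP[Jw1 w1_unc]].
have [|w0 [[/asboolP[Jw0 w0_unc] minw0] _]] :=
  wo [pred w | `[< J w /\ ~ countable (seg w) >]].
  by exists w1; apply/asboolP.
(* Segments are reflexive, so [w0] has to be removed: its own segment is uncountable. *)
exists (seg w0 `\ w0); split=> [w [[]]//||w [[Jw rww0] /= ww0]].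
- apply: contra_not w0_unc => c;
    apply: (@sub_countable _ _ _ (seg w0 `\ w0 `|` [set w0])).
    by apply: subset_card_le => w sw; have [->|/eqP ?] := eqVneq w w0;
      [right|left].
  rewrite -bigcup2E; apply: bigcup_countable => // -[|[|k]] _ //=.
- apply: contrapT => w_unc; apply: ww0; apply: anti => //.
  by rewrite rww0 minw0//; apply/asboolP.
Qed.

(** * Uncountable families of sets of positive measure under MA for measure algebras *)

Lemma class_of_set_neq0 d (T : measurableType d) (R : realType)
    (mu : {finite_measure set T -> \bar R}) (A : set T) (mA : measurable A) :
  mu A != 0%E -> class_of_set mu mA != \bot%O.
Proof.
apply: contra_neq => /class_of_setP A0; rewrite -(measure0 mu).
exact: ae_eq_measure.
Qed.

Lemma class_of_set_le d (T : measurableType d) (R : realType)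
    (mu : {finite_measure set T -> \bar R}) (b : measure_algebra mu)
    (A : set T) (mA : measurable A) :
  (b <= class_of_set mu mA)%O <-> {ae mu, forall x, repr_set b x -> A x}.
Proof.
have AP := repr_class_of_set mu mA; rewrite measure_algebra_leP.
by split; move: AP; apply: filterS2 => x; tauto.
Qed.

Section precaliber.
Context d (T : measurableType d) (R : realType).
Variable mu : {finite_measure set T -> \bar R}.
Variables (W : choiceType) (K : W -> set T).
Hypothesis mK : forall w, measurable (K w).
Hypothesis K_neq0 : forall w, mu (K w) != 0%E.
Hypothesis W_unc : ~ countable [set: W].

(* [C] is the complement of a largest set (modulo null sets) that is almost
   disjoint from all but countably many [K w]. *)
Lemma omega1_ess_limsup : exists C : set T,
  [/\ measurable C, mu C != 0%E &
      forall F N, measurable F -> countable N -> mu (F `&` C) != 0%E ->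
        exists2 w, ~ N w & mu (F `&` K w `&` C) != 0%E].
Proof.
pose avoid F := measurable F /\
  exists2 N : set W, countable N & forall w, ~ N w -> mu (F `&` K w) = 0%E.
have avoid0 : avoid set0.
  by split=> //; exists set0 => // w _; rewrite set0I measure0.
(* The countable exceptional sets of the [F n] have a countable union, and outside it each
   intersection with [K w] is a countable union of null sets. *)
have avoidU (F : nat -> set T) :
  (forall n, avoid (F n)) -> avoid (\bigcup_n F n).
  move=> avF; split; first by apply: bigcup_measurable => n _; exact: (avF n).1.
  have /choice[N NP] n : exists N : set W, countable N /\
      forall w, ~ N w -> mu (F n `&` K w) = 0%E.
    by have [_ [N ? ?]] := avF n; exists N.
  exists (\bigcup_n N n).
    by apply: bigcup_countable => // n _; exact: (NP n).1.
  move=> w Nw; rewrite setI_bigcupl; apply: measure_negligible.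
    by apply: bigcup_measurable => n _; apply: measurableI => //;
      exact: (avF n).1.
  apply: negligible_bigcup => n; apply/negligibleP.
    by apply: measurableI => //; exact: (avF n).1.
  by apply: (NP n).2 => Nnw; apply: Nw; exists n.
(* Exhaustion: the union [E] of sets in [avoid] whose measures approach the supremum attains it.
   Hence a set in [avoid] disjoint from [E] is null, since otherwise adding it to [E] would exceed
   the supremum. *)
pose ms := [set fine (mu F) | F in avoid].
have ms_sup : has_sup ms.
  split; first by exists (fine (mu set0)), set0.
  exists (fine (mu setT)) => _ [F [mF _] <-].
  apply: fine_le; [exact: fin_num_measure..|].
  by apply: le_measure; rewrite ?inE.
have /choice[F FP] (n : nat) :
  exists F, avoid F /\ sup ms - n.+1%:R^-1 < fine (mu F).
  have n0 : 0 < n.+1%:R^-1 :> R by rewrite invr_gt0 ltr0n.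
  by have [_ [F avF <-] ?] := sup_adherent n0 ms_sup; exists F.
pose E := \bigcup_n F n.
have avE : avoid E by apply: avoidU => n; exact: (FP n).1.
have mE : measurable E by case: avE.
have supE : sup ms <= fine (mu E).
  apply/ler_addgt0Pr => e e0; have [n n_lt] := ltr_add_invr e0.
  rewrite add0r in n_lt; rewrite -lerBlDr.
  apply: (@le_trans _ _ (sup ms - n.+1%:R^-1)); first by rewrite lerB// ltW.
  apply: (le_trans (ltW (FP n).2)); apply: fine_le.
  - by apply: fin_num_measure; have [[]] := FP n.
  - exact: fin_num_measure.
  - apply: le_measure; rewrite ?inE//; first by have [[]] := FP n.
    exact: bigcup_sup.
have avoid_null G : avoid G -> G `&` E = set0 -> mu G = 0%E.
  move=> avG GE; have mG : measurable G by case: avG.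
  have avGE : avoid (G `|` E).
    rewrite -bigcup2E; apply: avoidU => -[|[|k]]//=.
  have : fine (mu (G `|` E)) <= fine (mu E).
    apply: le_trans supE; apply: ub_le_sup; first by case: ms_sup.
    by exists (G `|` E).
  rewrite measureU// fineD ?fin_num_measure// gerDr => mG0.
  rewrite -[LHS]fineK ?fin_num_measure//; congr _%:E; apply/eqP.
  by rewrite eq_le mG0 fine_ge0.
exists (~` E); split; first exact: measurableC.
(* If [E] were conull, any [K w] with [w] outside the countable set [N] would be null, and such a
   [w] exists because [W] is uncountable. *)
- apply/eqP => C0; have [_ [N cN NE]] := avE.
  have [w Nw] : exists w, ~ N w.
    apply: contrapT => /forallNP allN; apply: W_unc.
    by rewrite (_ : setT = N)//; apply/seteqP; split=> // w _; apply: contrapT.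
  have /eqP := K_neq0 w; apply; rewrite -(setIT (K w)) -(setUv E) setIUr.
  have mKC : measurable (K w `&` ~` E) by apply: measurableI => //;
    exact: measurableC.
  have KC0 : mu (K w `&` ~` E) = 0%E.
    by apply: subset_measure0 C0 => //; exact: measurableC.
  rewrite (measureU0 (measurableI _ _ (mK w) mE) mKC KC0).
  by rewrite setIC; exact: NE.
(* If no such [w] existed, the part of [G] outside [E] would belong to [avoid], with exceptional set
   [N], and would therefore be null. *)
- move=> G N mG cN GC0; apply: contrapT => /forall2NP NG.
  have mGC : measurable (G `&` ~` E) by apply: measurableI => //;
    exact: measurableC.
  move/eqP: GC0; apply; apply: avoid_null; last first.
    by rewrite -setIA setICl setI0.
  split=> //; exists N => // w Nw; rewrite setIAC.
  by have [|/negP/negPn/eqP] := NG w.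
Qed.

(** A filter meeting omega_1 suitable dense sets has members below the classes of uncountably many
    [K v]. Finitely many of these classes lie above a common member of the filter, which is
    nonzero. *)
Lemma MA_uncountable_finI (lew : rel W) : MA_ma_omega1 R -> is_omega1 lew ->
  exists2 S : set W, ~ countable S & finI S K.
Proof.
move=> MA om; have [wo _ seg_c] := om.
have tot := wo_chainW (withinW (A := predT) wo).
have [C [mC C0 CP]] := omega1_ess_limsup.
(* The forcing is the algebra of the restriction of [mu] to [C]. A set of positive [nu]-measure
   meets some [K v] in positive [nu]-measure with [v] beyond any given [w], the initial segment of
   [w] being countable; so each [D w] below is dense. *)
pose nu : {finite_measure set T -> \bar R} := mrestr mu mC.
have nuE A : nu A = mu (A `&` C) by [].
pose B := measure_algebra nu.
pose k w : B := class_of_set nu (mK w).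
pose D w : set (nonzero B) := [set q | exists2 v, ~ lew v w & (val q <= k v)%O].
have denseD w : forcing_dense (D w).
  move=> p; have mp := measurable_repr_set (val p).
  have p0 : mu (repr_set (val p) `&` C) != 0%E.
    apply: contra (valP p) => /eqP pC0; apply/eqP/measure_algebra_eqP.
    have /(negligibleP nu mp) := pC0; rewrite -[X in X -> _]/(nu.-negligible _).
    move: (repr_set_bot nu) => bot0 p_null.
    have : {ae nu, forall x, ~ repr_set (val p) x}.
      by apply: negligibleS p_null => x /=; exact: contrapT.
    by move: bot0; apply: filterS2 => x; tauto.
  have [v vw pv0] := CP _ _ mp (seg_c w) p0.
  have mpv := measurableI _ _ mp (mK v).
  exists (to_nonzero (class_of_set_neq0 (mu := nu) mpv pv0)).
    exists v => //=; apply/class_of_set_le.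
    by move: (repr_class_of_set nu mpv);
      apply: filterS => x [] + _ => /[apply] -[].
  rewrite leEsub /=; apply/measure_algebra_leP.
  by move: (repr_class_of_set nu mpv);
    apply: filterS => x [] + _ => /[apply] -[].
have top0 : \bot%O != \top%O :> B.
  apply: contra_neq C0 => /measure_algebra_eqP bt.
  rewrite -[C]setTI -nuE -(measure0 nu); apply: ae_eq_measure => //.
  move: bt (repr_set_bot nu) (repr_set_top nu).
  by apply: filterS3 => x; rewrite /set0/=; tauto.
have isma := measure_algebra_is_measure_algebra nu.
have [G [G0 Gup Gdir] GD] :=
  MA _ _ _ isma top0 (measure_algebra_ccc isma) _ _ om _ denseD.
exists [set v | exists2 q, G q & (val q <= k v)%O].
  move=> S_c; have [_ W_unc' _] := om.
  (* A countable set of indices is bounded, since otherwise countably many countable segments would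
     cover [W]. But [D w] provides an index of the set beyond the bound [w]. *)
  have [w Sw] : exists w, forall v, (exists2 q, G q & (val q <= k v)%O) ->
    lew v w.
    apply: contrapT => /forallNP nw; apply: W_unc'.
    apply: sub_countable (bigcup_countable S_c (fun v _ => seg_c v)).
    apply: subset_card_le => w _; have /existsNP[v /not_implyP[Sv vw]] := nw w.
    by exists v => //=; have /orP[|] := tot v w isT isT.
  have [q [Gq [v vw qv]]] := GD w; apply: vw; apply: Sw; by exists q.
move=> F FS.
suff [q Gq qF] : exists2 q, G q & forall v, v \in (F :
  seq W) -> (val q <= k v)%O.
  (* Almost every point of the representative of [q] lies in all [K v] with [v] in [F]; an empty
     intersection would make [q] the zero class. *)
  apply: contrapT => K0; have /negP := valP q; apply;
    apply/eqP/measure_algebra_eqP.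
  have : \forall x \ae nu, (\bigcap_(v in [set` F])
      [set x | repr_set (val q) x -> K v x]) x.
    by apply: filter_bigI => v vF; apply/class_of_set_le; exact: qF.
  move: (repr_set_bot nu); apply: filterS2 => x bot qK; split=> // qx.
  by exfalso; apply: K0; exists x => v /= vF; exact: qK.
have {}FS v : v \in (F : seq W) -> exists2 q, G q & (val q <= k v)%O.
  by move=> /FS/set_mem.
elim: (F : seq W) FS => [|v s IH] FS.
  by have [q Gq] := G0; exists q => // v; rewrite in_nil.
have [u su|q Gq qs] := IH.
  by apply: FS; rewrite inE su orbT.
have [p Gp pv] := FS v (mem_head _ _).
have [r [Gr rp rq]] := Gdir _ _ Gp Gq.
rewrite !leEsub in rp rq; exists r => // u; rewrite inE => /predU1P[->|/qs].
  exact: le_trans rp pv.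
exact: le_trans.
Qed.

End precaliber.

(** * Separable measures and Radon measures on compact spaces *)

Lemma separable_measureP d (T : measurableType d) (R : realType)
    (mu : {finite_measure set T -> \bar R}) :
  separable_measure mu <-> exists H : set (set T),
    [/\ countable H, H `<=` measurable & forall A e, measurable A -> 0 < e ->
        exists2 B, H B & (mu (A `+` B) < e%:E)%E].
Proof.
(* Balls of the quotient are expressed through symmetric differences of sets; density then becomes
   an approximation property of a countable family of measurable sets. *)
have ballE A (mA : measurable A) e (b : measure_algebra mu) :
    ball (class_of_set mu mA) e b <-> (mu (A `+` repr_set b) < e%:E)%E.
  rewrite -[X in ball _ _ X]repr_setK.
  rewrite -[X in X <-> _]/(is_true (measure_algebra_dist _ _ < e)).
  rewrite measure_algebra_distE /= -lte_fin fineK//; apply: fin_num_measure.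
  have mb := measurable_repr_set b.
  by apply: measurableU; exact: measurableD.
split=> [[D cD dD]|[H [cH mH HP]]].
  exists (@repr_set _ _ _ mu @` D); split; first exact: countable_image.
    by move=> _ [b _ <-]; exact: measurable_repr_set.
  move=> A e mA e0; have := dD (interior (ball (class_of_set mu mA) e)).
  case=> [|| b [/interior_subset/ballE be Db]].
  - by exists (class_of_set mu mA); exact: nbhsx_ballx.
  - exact: open_interior.
  - by exists (repr_set b) => //; exists b.
exists [set b : measure_algebra mu | exists2 B : (measurable : set (set T)),
    H (val B) & b = measure_class mu B].
  apply: sub_countable (countable_image (measure_class mu)
    (countable_preimage val_inj cH)).
  by apply: subset_card_le => b [B HB ->]; exists B.
move=> O [a Oa] oO; have : nbhs a O by exact: open_nbhs_nbhs.
move=> /nbhs_ballP[e /= e0 aeO]; have ma := measurable_repr_set a.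
have [B HB aB] := HP _ _ ma e0.
exists (class_of_set mu (mH _ HB)); split; last first.
  by exists (exist _ B (mem_set (mH _ HB))).
apply: aeO; rewrite -(repr_setK a); apply/ballE.
apply: le_lt_trans aB; apply: ae_le_measure.
- by apply: measurableU; apply: measurableD => //; exact: measurable_repr_set.
- by apply: measurableU; apply: measurableD => //; exact: mH.
- have := repr_class_of_set mu (mH _ HB).
  by apply: filterS => x; rewrite /setY/=; tauto.
Qed.

Section regular_measures.
Context (R : realType) (T : topologicalType) (x0 : T).
Variable mu : {finite_measure set (borel x0) -> \bar R}.

Lemma open_measurable_borel (U : set T) : open U -> measurable (U :
  set (borel x0)).
Proof. exact: sub_sigma_algebra. Qed.

Lemma closed_measurable_borel (U : set T) :
  closed U -> measurable (U : set (borel x0)).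
Proof.
by move=> cU; rewrite -[U]setCK; apply: measurableC;
  apply: open_measurable_borel; exact: closed_openC.
Qed.

Hypothesis T_hausdorff : hausdorff_space T.

Lemma compact_measurable_borel (K : set T) :
  compact K -> measurable (K : set (borel x0)).
Proof. by move=> /(compact_closed T_hausdorff);
  exact: closed_measurable_borel. Qed.

Hypothesis mu_regular : regular_measure mu.

Lemma regular_measure_inner (A : set T) (e : R) :
  measurable (A : set (borel x0)) -> 0 < e ->
  exists K, [/\ compact K, K `<=` A & (mu (A `\` K) < e%:E)%E].
Proof.
move=> mA e0; have [supA _] := mu_regular mA.
have finA := fin_num_measure mu _ mA.
have [|_ [K [cK KA] <-]] := ub_ereal_sup_adherent e0 (S := [set mu K | K in
    [set K : set T | compact K /\ K `<=` A]]); first by rewrite -supA.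
rewrite -supA => AK; exists K; split=> //.
have mK := compact_measurable_borel cK.
rewrite measureD// ?setIidr// -?ge0_fin_numE//.
by rewrite lteBlDr ?fin_num_measure// addeC -lteBlDr.
Qed.

Lemma regular_measure_outer (A : set T) (e : R) :
  measurable (A : set (borel x0)) -> 0 < e ->
  exists U, [/\ open U, A `<=` U & (mu (U `\` A) < e%:E)%E].
Proof.
move=> mA e0; have [_ infA] := mu_regular mA.
have finA := fin_num_measure mu _ mA.
have [|_ [U [oU AU] <-]] := lb_ereal_inf_adherent e0 (S := [set mu U | U in
    [set U : set T | open U /\ A `<=` U]]); first by rewrite -infA.
rewrite -infA => AK; exists U; split=> //.
have mU := open_measurable_borel oU.
rewrite measureD// ?setIidr//; last by rewrite -ge0_fin_numE// fin_num_measure.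
by rewrite lteBlDr ?fin_num_measure// addeC.
Qed.

Hypothesis T_compact : compact [set: T].

(** Otherwise omega_1 of the [U i] contain non-null compact sets. An uncountable subfamily of these
    with the finite intersection property has a common point by compactness, and that point lies in
    uncountably many [U i]. *)
Lemma point_countable_open_null (I : choiceType) (U : I -> set T) :
  MA_ma_omega1 R -> (forall i, open (U i)) ->
  (forall x, countable [set i | U i x]) -> countable [set i | mu (U i) != 0%E].
Proof.
move=> MA oU cU; apply: contrapT => /uncountable_omega1[A AU [r om]].
have /choice[K KP] (w : A) : exists K : set T,
    [/\ compact K, K `<=` U (val w) & mu K != 0%E].
  have Uw0 : mu (U (val w)) != 0%E by exact: AU (set_mem (valP w)).
  have mU := open_measurable_borel (oU (val w)).
  have U0 : 0 < fine (mu (U (val w))).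
    by rewrite lt0r fine_ge0// andbT fine_eq0// fin_num_measure.
  (* The tolerance is the measure of the open set itself, so [K] cannot be null. *)
  have [K [cK KU UK]] := regular_measure_inner mU U0.
  exists K; split=> //; apply: contraTneq UK => K0.
  rewrite fineK ?fin_num_measure// measureD//.
  - by rewrite setIidr// [X in (_ - X)%E](_ : _ = 0%E)// sube0 ltxx.
  - exact: compact_measurable_borel.
  - by rewrite -ge0_fin_numE// fin_num_measure.
have mK w : measurable (K w : set (borel x0)).
  by apply: compact_measurable_borel; have [] := KP w.
have K0 w : mu (K w) != 0%E by have [] := KP w.
have [_ W_unc _] := om.
have [S S_unc SK] := MA_uncountable_finI mK K0 W_unc MA om.
have : compact [set: pointed_at x0] by [].
rewrite compact_In0 => /(_ _ S K)[|//|x xK].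
  exists K => w _; last by rewrite setTI.
  by apply: compact_closed => //; have [] := KP w.
apply: S_unc; apply: sub_countable (countable_preimage val_inj (cU x)).
apply: subset_card_le => w Sw /=.
by have [_ KU _] := KP w; apply: KU; exact: xK.
Qed.

End regular_measures.

(** * Images of Radon measures under continuous maps *)

Section image_measure.
Context (R : realType) (T X : topologicalType) (x0 : T) (f : T -> X).
Variable mu : {finite_measure set (borel x0) -> \bar R}.

(** The proof of continuity is an argument so that the term [image_measure cf] can carry the
    structure of a finite measure. *)
Definition image_measure of continuous f := fun A : set (borel (f x0)) =>
  mu (f @^-1` A).

Hypothesis cf : continuous f.

Lemma continuous_measurable_borel (A : set (borel (f x0))) :
  measurable A -> measurable (f @^-1` A : set (borel x0)).
Proof.
have mf : measurable_fun setT (f : borel x0 -> borel (f x0)).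
  apply: (@measurability _ _ (borel x0) (borel (f x0)) setT f
    (@open (pointed_at (f x0))) erefl) => _ [U oU <-].
  by rewrite setTI; apply: open_measurable_borel; move/continuousP: cf; exact.
by move=> mA; rewrite -[X in measurable X]setTI; exact: mf.
Qed.

Let image_measure0 : image_measure cf set0 = 0%E.
Proof. by rewrite /image_measure preimage_set0 measure0. Qed.

Let image_measure_ge0 A : (0 <= image_measure cf A)%E.
Proof. exact: measure_ge0. Qed.

Let image_measure_semi_sigma_additive : semi_sigma_additive (image_measure cf).
Proof.
move=> F mF tF mUF; rewrite /image_measure preimage_bigcup.
apply: measure_semi_sigma_additive.
- by move=> n; exact: continuous_measurable_borel.
- apply/trivIsetP => /= i j _ _ ij; rewrite -preimage_setI.
  by move/trivIsetP : tF => /(_ _ _ _ _ ij) ->//; rewrite preimage_set0.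
- by rewrite -preimage_bigcup; exact: continuous_measurable_borel.
Qed.

HB.instance Definition _ := isMeasure.Build _ _ _ (image_measure cf)
  image_measure0 image_measure_ge0 image_measure_semi_sigma_additive.

Let image_measure_fin : fin_num_fun (image_measure cf).
Proof.
by move=> A mA; apply: fin_num_measure; exact: continuous_measurable_borel.
Qed.

HB.instance Definition _ :=
  Measure_isFinite.Build _ _ _ (image_measure cf) image_measure_fin.

(** Inner regularity passes to the image because continuous images of compact sets are compact.
    Outer regularity follows by applying it to complements, compact subsets of the Hausdorff space
    [X] being closed. *)
Lemma image_measure_regular : compact [set: T] -> hausdorff_space T ->
  hausdorff_space X -> regular_measure mu -> regular_measure (image_measure cf).
Proof.
move=> cT hT hX mu_reg.
have sup_image A : measurable (A : set (borel (f x0))) -> forall e : R, 0 < e ->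
    exists K, [/\ compact K, K `<=` A & (image_measure cf (A `\` K) < e%:E)%E].
  move=> mA e e0.
  have [K [cK KA AK]] :=
    regular_measure_inner hT mu_reg (continuous_measurable_borel mA) e0.
  have cfK : compact (f @` K) by apply: continuous_compact => //;
    exact: continuous_subspaceT.
  exists (f @` K); split=> //; first by move=> _ [x Kx <-]; exact: KA.
  apply: le_lt_trans AK; rewrite /image_measure; apply: le_measure;
    rewrite ?inE.
  - by apply: continuous_measurable_borel; apply: measurableD => //;
      exact: compact_measurable_borel.
  - apply: measurableD; first exact: continuous_measurable_borel.
    exact: compact_measurable_borel.
  - by move=> x [Ax nKx]; split=> // Kx; apply: nKx; exists x.
move=> A mA; split; apply/eqP; rewrite eq_le; apply/andP; split.
- apply/lee_addgt0Pr => e e0; have [K [cK KA AK]] := sup_image _ mA e e0.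
  have mK : measurable (K : set (borel (f x0)))
    by exact: compact_measurable_borel.
  rewrite -{1}(setDUK KA) measureU//; [|exact: measurableD|exact: setDIK].
  apply: leeD; last exact: ltW.
  by apply/ereal_sup_ubound; exists K.
- apply: ge_ereal_sup => _ [K [cK KA] <-]; apply: le_measure; rewrite ?inE//.
  exact: compact_measurable_borel.
- apply: le_ereal_inf_tmp => _ [U [oU AU] <-]; apply: le_measure;
    rewrite ?inE//.
  exact: open_measurable_borel.
- apply/lee_addgt0Pr => e e0.
  have [K [cK KA AK]] := sup_image _ (measurableC mA) e e0.
  have mK : measurable (K : set (borel (f x0)))
    by exact: compact_measurable_borel.
  have AKC : A `<=` ~` K by move=> x Ax /KA.
  apply: (@le_trans _ _ (image_measure cf (~` K))).
    apply: ereal_inf_lbound; exists (~` K) => //; split=> //.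
    by apply: closed_openC; exact: compact_closed hX cK.
  rewrite -{1}(setDUK AKC) measureU//.
  + by apply: leeD => //; rewrite setDE setIC -setDE; exact: ltW.
  + by apply: measurableD => //; exact: measurableC.
  + exact: setDIK.
Qed.

End image_measure.

(** * Approximation by a countable lattice of sets *)

Lemma countable_lattice_closure T (G : set (set T)) : countable G ->
  exists H : set (set T), [/\ countable H, G `<=` H, setU_closed H, setI_closed
    H &
    forall M, G `<=` M -> setU_closed M -> setI_closed M -> H `<=` M].
Proof.
move=> cG.
(* The closure is the union of the countable stages obtained by iterating [step]. Its minimality
   acts as an induction principle, used later to show that its members are measurable. *)
pose step (H : set (set T)) := H `|`
  ([set AB.1 `|` AB.2 | AB in H `*` H] `|` [set AB.1 `&` AB.2 | AB in H `*` H]).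
pose H n := iter n step G.
have H_le m n : (m <= n)%N -> H m `<=` H n.
  move=> /subnK <-; elim: (n - m)%N => // k IH A /IH HA; left.
  exact: HA.
have H_op m n A B : H m A -> H n B ->
  H (m + n).+1 (A `|` B) /\ H (m + n).+1 (A `&` B).
  move=> /(H_le _ _ (leq_addr n m)) HA /(H_le _ _ (leq_addl m n)) HB.
  by split; right; [left|right]; exists (A, B).
have cU (A B : set (set T)) : countable A -> countable B -> countable (A `|` B).
  by move=> cA cB; rewrite -bigcup2E; apply: bigcup_countable => // -[|[|k]].
exists (\bigcup_n H n); split.
- apply: bigcup_countable => // n _; elim: n => // n IH.
  by apply: (cU) => //; apply: cU; apply: countable_image; exact: countableX.
- by move=> A GA; exists 0%N.
- by move=> A B [m _ HA] [n _ HB]; exists (m + n).+1 => //;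
    have [] := H_op m n A B.
- by move=> A B [m _ HA] [n _ HB]; exists (m + n).+1 => //;
    have [] := H_op m n A B.
- move=> M GM MU MI A [n _]; elim: n A => [|n IH] A; first exact: GM.
  case=> [/IH//|[] [[B C] [/= /IH MB /IH MC] <-]]; [exact: MU|exact: MI].
Qed.

(** By compactness, a separating family of continuous maps into Hausdorff spaces generates the
    topology: finitely many coordinatewise separations of [x] from points outside [O] cover the
    complement of [O]. The predicate [P] records what is preserved by finite intersections, and will
    be approximability. *)
Lemma separating_open_nbhs (T : topologicalType) (I : choiceType)
    (X : I -> topologicalType) (f : forall i, T -> X i) (P : set T -> Prop) :
  compact [set: T] -> (forall i, hausdorff_space (X i)) ->
  (forall i, continuous (f i)) ->
  (forall x y, (forall i, f i x = f i y) -> x = y) ->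
  P setT -> (forall A B, P A -> P B -> P (A `&` B)) ->
  (forall i U, open U -> P (f i @^-1` U)) ->
  forall x O, open O -> O x -> exists V, [/\ P V, open V, V x & V `<=` O].
Proof.
move=> cT hX cf sep PT PI Pf x O oO Ox.
have /choice[VW VWP] (y : T) : exists VW : set T * set T,
    [/\ [/\ P VW.1, open VW.1 & VW.1 x], open VW.2, ~ O y -> VW.2 y &
        VW.1 `&` VW.2 = set0].
  have [Oy|nOy] := pselect (O y).
    (* A dummy pair makes the choice function total; it only adds the whole space to the
       intersection. *)
    by exists (setT, set0); split=> //=; [split=> //;
      exact: openT|exact: open0|rewrite setI0].
  have [i fxy] : exists i, f i x <> f i y.
    apply: contrapT => /forallNP fxy; apply: nOy; suff <- : x = y by [].
    by apply: sep => i; exact: contrapT.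
  have := hX i; rewrite open_hausdorff => /(_ (f i x) (f i y)) [|[V W] /=].
    exact/eqP.
  rewrite !inE => -[Vx Wy] [oV oW VW].
  exists (f i @^-1` V, f i @^-1` W); split=> //=.
  - by split=> //; [exact: Pf|by move/continuousP: (cf i); exact].
  - by move/continuousP: (cf i); exact.
  - by rewrite -preimage_setI VW preimage_set0.
have : @compact (pointed_at x) (~` O).
  by apply: subclosed_compact cT _ => //; exact: open_closedC.
rewrite compact_cover => /(_ _ setT (fun y => (VW y).2))[|y nOy|F _ FO].
- by move=> y _; have [] := VWP y.
- by exists y => //; have [_ _ + _] := VWP y; apply.
pose V := \big[setI/setT]_(y <- (F : seq T)) (VW y).1.
have [PV oV Vx] : [/\ P V, open V & V x].
  rewrite /V; apply: (big_ind (fun V => [/\ P V, open V & V x])).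
  - by split=> //; exact: openT.
  - by move=> A B [? ? ?] [? ? ?]; split; [exact: PI|exact: openI|split].
  - by move=> y _; have [] := VWP y.
exists V; split=> // z Vz; apply: contrapT => nOz.
have [y /= yF VWz] := FO z nOz; have [_ _ _ VW0] := VWP y.
suff : ((VW y).1 `&` (VW y).2) z by rewrite VW0.
split=> //; move: Vz; rewrite /V -bigcap_seq; exact.
Qed.

Section approximable.
Context d (T : measurableType d) (R : realType).
Variables (mu : {finite_measure set T -> \bar R}) (H : set (set T)).

Definition approximable (A : set T) := measurable A /\
  forall e : R, 0 < e -> exists2 B, H B & (mu (A `+` B) < e%:E)%E.

Hypothesis mH : H `<=` measurable.

(** The symmetric difference of two results lies in the union of the symmetric differences of the
    arguments, so an error of [e / 2] for each argument suffices. *)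
Let approximable_op (op : set T -> set T -> set T) :
  (forall A B, measurable A -> measurable B -> measurable (op A B)) ->
  (forall A B, H A -> H B -> H (op A B)) ->
  (forall A B A' B', op A A' `+` op B B' `<=` (A `+` B) `|` (A' `+` B')) ->
  forall A A', approximable A -> approximable A' -> approximable (op A A').
Proof.
move=> mop Hop opY A A' [mA AP] [mA' AP']; split; first exact: mop.
move=> e e0; have e20 : 0 < e / 2 by rewrite divr_gt0.
have [[B HB AB] [B' HB' AB']] := (AP _ e20, AP' _ e20).
have mY (C C' : set T) : measurable C -> measurable C' -> measurable (C `+` C').
  by move=> ? ?; apply: measurableU; exact: measurableD.
have [mB mB'] := (mH HB, mH HB').
exists (op B B'); first exact: Hop.
apply: (@le_lt_trans _ _ (mu ((A `+` B) `|` (A' `+` B')))).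
  apply: le_measure; rewrite ?inE//; first by apply: mY; exact: mop.
  by apply: measurableU; exact: mY.
apply: (@le_lt_trans _ _ (mu (A `+` B) + mu (A' `+` B'))%E).
  by apply: measureU2; exact: mY.
by rewrite [e]splitr EFinD lteD.
Qed.

Lemma approximableU (A A' : set T) : setU_closed H ->
  approximable A -> approximable A' -> approximable (A `|` A').
Proof.
move=> HU; apply: (approximable_op (op := setU)) => //; first by move=> *;
  exact: measurableU.
move=> {}A B {}A' B' x; rewrite /setY /setU /setD /=.
have := pselect (A x); have := pselect (B x); have := pselect (A' x).
by have := pselect (B' x); tauto.
Qed.

Lemma approximableI (A A' : set T) : setI_closed H ->
  approximable A -> approximable A' -> approximable (A `&` A').
Proof.
move=> HI; apply: (approximable_op (op := setI)) => //; first by move=> *;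
  exact: measurableI.
move=> {}A B {}A' B' x; rewrite /setY /setI /setU /setD /=.
have := pselect (A x); have := pselect (B x); have := pselect (A' x).
by have := pselect (B' x); tauto.
Qed.

Lemma approximable_id (A : set T) : H A -> approximable A.
Proof.
by move=> HA; split; [exact: mH|move=> e e0; exists A;
  rewrite ?setYK ?measure0].
Qed.

Lemma approximable_ae (A B : set T) : measurable A -> H B ->
  {ae mu, forall x, A x <-> B x} -> approximable A.
Proof.
move=> mA HB AB; split=> // e e0; exists B => //.
by rewrite (null_setYP mu mA (mH HB)).2.
Qed.

End approximable.

(** Formulated with maps that separate points, so that the Sigma-product enters only through its
    coordinates: [fa] says that each point differs from [a] in countably many of them. *)
Lemma separating_MS (R : realType) (T : topologicalType) (I : choiceType)
    (X : I -> topologicalType) (f : forall i, T -> X i) (a : forall i, X i) :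
  MA_ma_omega1 R -> (forall i, MS R (X i)) -> compact [set: T] ->
  (forall i, continuous (f i)) ->
  (forall x y, (forall i, f i x = f i y) -> x = y) ->
  (forall x, countable [set i | f i x <> a i]) -> MS R T.
Proof.
move=> MA hX cT cf sep fa.
have X_hausdorff i : hausdorff_space (X i) by have [] := hX i.
have T_hausdorff : hausdorff_space T.
  move=> x y xy; apply: sep => i; apply: X_hausdorff => A B Afx Bfy.
  by have [z [Az Bz]] := xy _ _ (cf i _ _ Afx) (cf i _ _ Bfy); exists (f i z).
split=> // x0 mu mu_reg; apply/separable_measureP.
(* By [fa] each point lies in only countably many of these open sets, hence only countably many of
   them are non-null. *)
pose U i : set T := f i @^-1` (~` [set a i]).
have oU i : open (U i).
  move/continuousP: (cf i); apply; apply: closed_openC.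
  by apply: compact_closed; [exact: X_hausdorff|exact: compact_set1].
pose J := [set i | mu (U i) != 0%E].
have cJ : countable J.
  exact: (point_countable_open_null T_hausdorff mu_reg cT MA oU fa).
have HX_ex i : exists H : set (set (X i)),
    [/\ countable H, H `<=` (measurable : set (set (borel (f i x0)))) &
     forall A e, measurable (A : set (borel (f i x0))) -> 0 < e ->
        exists2 B, H B & (mu (f i @^-1` (A `+` B)) < e%:E)%E].
  have [_ _ Xi] := hX i.
  apply/(separable_measureP (image_measure mu (cf i))).
  by apply: Xi; apply: image_measure_regular.
pose HX i := sval (cid (HX_ex i)).
have HXP i : [/\ countable (HX i),
    HX i `<=` (measurable : set (set (borel (f i x0)))) &
    forall A e, measurable (A : set (borel (f i x0))) -> 0 < e ->
      exists2 B, HX i B & (mu (f i @^-1` (A `+` B)) < e%:E)%E].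
  exact: svalP (cid (HX_ex i)).
(* The empty set and the whole space account for all coordinates outside [J], where preimages of
   open sets are null or conull. *)
pose G : set (set T) := [set set0; setT] `|`
  \bigcup_(i in J) [set f i @^-1` B | B in HX i].
have cG : countable G.
  have cst : countable [set set0; setT : set T].
    by apply: finite_set_countable; exact: finite_set2.
  rewrite /G -bigcup2E; apply: bigcup_countable => // -[|[|k]] _ //=.
  apply: bigcup_countable => // i _; apply: countable_image.
  by have [] := HXP i.
pose mT : set (set T) := (measurable : set (set (borel x0))).
have mG : G `<=` mT.
  move=> A [[->|->]|[i _ [B HB <-]]]; [exact: measurable0|exact: measurableT|].
  by apply: continuous_measurable_borel => //; have [_ + _] := HXP i; apply.
have [H [cH GH HU HI Hmin]] := countable_lattice_closure cG.
have mH : H `<=` mT.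
  by apply: Hmin => // A B; [exact: measurableU|exact: measurableI].
exists H; split=> // A e mA e0.
have H0 : H set0 by apply: GH; left; left.
have HT : H setT by apply: GH; left; right.
pose approx := @approximable _ (borel x0) R mu H.
have approx_preimage i (O : set (X i)) : open O -> approx (f i @^-1` O).
  move=> oO; have mO : measurable (O : set (borel (f i x0))).
    exact: open_measurable_borel.
  have mfO := continuous_measurable_borel (cf i) mO.
  have [Ji|nJi] := pselect (J i).
    split=> // e' e'0; have [_ _ HXi] := HXP i;
      have [B HB OB] := HXi _ _ mO e'0.
    by exists (f i @^-1` B) => //; apply: GH; right; exists i => //; exists B.
  (* This coordinate is almost everywhere equal to [a i], so the preimage of [O] is conull or null
     according to whether [O] contains [a i]. *)
  have U0 : {ae mu, forall x, f i x = a i}.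
    have /(negligibleP mu (open_measurable_borel (x0 :=
      x0) (oU i))) : mu (U i) = 0%E.
      by apply/eqP; apply: contrapT => /negP.
    exact: negligibleS.
  have [Oa|nOa] := pselect (O (a i)).
    by apply: (approximable_ae (mu := mu) mH mfO HT); move: U0;
      apply: negligibleS => x; apply: contra_not => /= ->.
  by apply: (approximable_ae (mu := mu) mH mfO H0); move: U0;
    apply: negligibleS => x; apply: contra_not => /= ->.
(* Three errors add up: from [K] to [A], from [A] to [W], and from [VF] to [B]. The finite union
   [VF] of approximable open sets lies between [K] and [W], so it differs from [A] only within the
   first two. *)
have e30 : 0 < e / 3 by rewrite divr_gt0.
have [K [cK KA AK]] := regular_measure_inner T_hausdorff mu_reg mA e30.
have [W [oW AW WA]] := regular_measure_outer mu_reg mA e30.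
have /choice[V VP] (x : T) : exists V :
  set T, K x -> [/\ approx V, open V, V x & V `<=` W].
  have [Kx|nKx] := pselect (K x); last by exists set0 => /nKx.
  have approxI B C : approx B -> approx C -> approx (B `&` C).
    by move=> aB aC; exact: (approximableI (mu := mu) mH HI aB aC).
  have [V VP] := separating_open_nbhs cT X_hausdorff cf sep
    (approximable_id mu mH HT) approxI approx_preimage oW (AW _ (KA _ Kx)).
  by exists V.
have : @compact (pointed_at x0) K by [].
rewrite compact_cover => /(_ _ K V)[x Kx|x Kx|F FK KF].
- by have [] := VP x Kx.
- by exists x => //; have [] := VP x Kx.
pose VF := \big[setU/set0]_(x <- (F : seq T)) V x.
have KVF : K `<=` VF by move=> x /KF; rewrite /VF -bigcup_seq.
have [approxVF VFW] : approx VF /\ VF `<=` W.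
  rewrite /VF big_seq; apply: (big_ind (fun V => approx V /\ V `<=` W)).
  - by split=> //; exact: (approximable_id mu mH H0).
  - move=> B C [aB BW] [aC CW]; split;
      first exact: (approximableU (mu := mu) mH HU aB aC).
    by rewrite subUset.
  - by move=> x /FK/set_mem Kx; have [] := VP x Kx.
have [mVF VFP] := approxVF; have [B HB VFB] := VFP _ e30.
exists B => //.
have [mB mW] := (mH _ HB, open_measurable_borel (x0 := x0) oW).
have mK := compact_measurable_borel (x0 := x0) T_hausdorff cK.
have [mAK mWA] := (measurableD mA mK, measurableD mW mA).
have mVB : measurable (VF `+` B : set (borel x0)).
  by apply: measurableU; exact: measurableD.
apply: (@le_lt_trans _ _ (mu ((A `\` K) `|` (W `\` A) `|` (VF `+` B)))).
  apply: le_measure; rewrite ?inE.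
  - by apply: measurableU; exact: measurableD.
  - by apply: measurableU => //; exact: measurableU.
  - move=> x; have := KVF x; have := VFW x.
    rewrite /setY /setU /setD /=.
    by have [] := pselect (A x); have [] := pselect (VF x);
      have [] := pselect (B x); tauto.
apply: (@le_lt_trans _ _ (mu (A `\` K) + mu (W `\` A) + mu (VF `+` B))%E).
  apply: (@le_trans _ _ (mu ((A `\` K) `|` (W `\` A)) + mu (VF `+` B))%E).
    by apply: measureU2 => //; exact: measurableU.
  by rewrite leeD2r//; exact: measureU2.
have -> : e = e / 3 + e / 3 + e / 3 by field.
by rewrite !EFinD lteD// lteD.
Qed.

(** * Compact subspaces of the Sigma-product *)

Lemma compact_set_type (T : topologicalType) (A : set T) :
  compact A -> compact [set: A].
Proof.
move=> cA F FF _; have FA : (set_val @ F) A.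
  apply: (@filterS _ F _ setT); last exact: filterT.
  by move=> [x xA] _; exact: set_mem.
have [x [Ax xF]] := cA _ _ FA; exists (SigSub (mem_set Ax)); split=> // B C FB.
case=> _ [[U oU <-] /= Ux UC].
have [_ [[b Bb <-] Ub]] : (set_val @` B) `&` U !=set0.
  apply: xF; last exact: open_nbhs_nbhs.
  apply: (@filterS _ F _ B _ _ FB).
  by move=> b Bb; exists b.
by exists b; split=> //; exact: UC.
Qed.

Theorem theorem2p5 (R : realType) (MA : MA_ma_omega1 R)
    (I : Type) (X : I -> topologicalType) (hX : forall i, MS R (X i))
    (a : prod_topology X) (Y : set (prod_topology X))
    (cptY : compact Y) (subY : Y `<=` Sigma_product a) :
  MS R Y.
Proof.
(* [{classic I}] equips the arbitrary index type with the choice structure that [separating_MS]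
   requires. *)
pose f (i : {classic I}) (y : Y) : X i := val y i.
apply: (@separating_MS R Y {classic I} X f a) => //.
- exact: compact_set_type.
- move=> i y; apply: (@continuous_comp Y (prod_topology X) (X i) set_val
    (fun x => x i) y); first exact: initial_continuous.
  exact: (@proj_continuous {classic I} X i).
- by move=> x y fxy; apply: val_inj; apply: functional_extensionality_dep.
- by move=> y; exact: subY (set_mem (valP y)).
Qed.
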